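(* Let $k\geq 1$, let $G_i=(V_i,E_i)$ for $1\le i\le k$ and $H=(V_H,E_H)$ be pairwise vertex-disjoint, connected graphs, each with at least two vertices, let $u_i\in V_i$ for $i=1,\dots,k$, and let $v_1,\dots,v_k\in V_H$ (not necessarily distinct). Let $J=(V_J,E_J)$ be the composed graph $G_{1,\ldots,k}\circ^{u_1,\dots,u_k}_{v_1,\dots,v_k}H$. Then for two distinct vertices $w_1,w_2\in V_J$, $\{w_1,w_2\}$ is an edge of the strong resolving graph $\mathrm{SR}(J)$ if and only if $w_1,w_2\notin\{v_1,\dots,v_k\}$ and one of the following holds: (1) $w_1,w_2\in V_i$ for some $i$, $1\le i\le k$, and $w_1,w_2$ are mutually maximally distant in $G_i$; (2) $w_1,w_2\in V_H$ and $w_1,w_2$ are mutually maximally distant in $H$; (3) $w_1\in V_i$ and $w_2\in V_j$ for some $1\le i<j\le k$, $w_1$ is maximally distant from $u_i$ in $G_i$ and $w_2$ is maximally distant from $u_j$ in $G_j$; or (4) $w_1\in V_i$ for some $i$, $1\le i\le k$, $w_2\in V_H$, $w_1$ is maximally distant from $u_i$ in $G_i$ and $w_2$ is maximally distant from $v_i$ in $H$.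
   Context: All graphs are finite, undirected and simple. In a connected graph $G$, $d_G(x,y)$ is the distance and $N_G(x)$ the set of neighbours of $x$. A vertex $u$ is maximally distant from a vertex $w$ in $G$ if there is no $v\in N_G(u)$ with $d_G(v,w)>d_G(u,w)$. Two vertices are mutually maximally distant if each is maximally distant from the other. The strong resolving graph $\mathrm{SR}(G)$ has the same vertex set as $G$, with an edge between distinct $u,v$ iff $u,v$ are mutually maximally distant in $G$. The composed graph $J=G_{1,\ldots,k}\circ^{u_1,\dots,u_k}_{v_1,\dots,v_k}H$ has vertex set $(V_1\cup\dots\cup V_k\cup V_H)\setminus\{u_1,\dots,u_k\}$ and edge set $(E_1\cup\dots\cup E_k\cup E_H\cup\{\{x,v_i\}: x\in N_{G_i}(u_i),1\le i\le k\})\setminus\{\{x,u_i\}: x\in N_{G_i}(u_i),1\le i\le k\}$; i.e. $J$ is obtained from the disjoint union by identifying each $u_i$ with $v_i$. *)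

(* Defs.v *)
From mathcomp Require Import all_boot.

Set Implicit Arguments.
Unset Strict Implicit.
Unset Printing Implicit Defensive.

(* Vertices of all graphs under consideration live in one ambient finite type
   U, so that vertex-disjointness and unions of graphs are the set-theoretic
   notions.  An edge is an unordered pair, i.e. a two-element set. *)
Record graph (U : finType) := Graph {
  vertices : {set U};
  edges : {set {set U}}
}.

Section Graphs.

Variable U : finType.
Implicit Types (G H : graph U) (x y u v w : U).

Definition simple_graph G :=
  forall e, e \in edges G -> e \subset vertices G /\ #|e| = 2.

Definition adj G x y := [set x; y] \in edges G.

Definition nbrs G x := [set y | adj G x y].

Definition connected_graph G :=
  {in vertices G &, forall x y, connect (adj G) x y}.

Definition has_walk G x y n :=
  [exists p : n.-tuple U, path (adj G) x p && (last x p == y)].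

(* Least length of a walk from x to y.  A shortest walk has at most #|U| - 1
   edges; the value is #|U| exactly when x and y are not connected. *)
Definition dist G x y := find (has_walk G x y) (iota 0 #|U|).

Definition max_distant G u w :=
  ~~ [exists v in nbrs G u, dist G v w > dist G u w].

Definition mutually_max_distant G u w :=
  max_distant G u w && max_distant G w u.

Definition strong_resolving_graph G : graph U := Graph (vertices G)
  [set [set x; y] | x in vertices G, y in vertices G
                  & (x != y) && mutually_max_distant G x y].

Definition composed_graph k (G : 'I_k -> graph U) H (u v : 'I_k -> U) :=
  Graph
    (((\bigcup_i vertices (G i)) :|: vertices H) :\: [set u i | i : 'I_k])
    (((\bigcup_i edges (G i)) :|: edges H
        :|: \bigcup_i [set [set x; v i] | x in nbrs (G i) (u i)])
      :\: \bigcup_i [set [set x; u i] | x in nbrs (G i) (u i)]).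

End Graphs.

(* Main.v *)
(* Seen from a piece (some G_i, or H), every vertex w of the composed graph has
   a gate in that piece: w itself if it lies there, and otherwise the vertex
   through which the piece is attached.  The distance to w from the vertices of
   the piece is the distance to the gate plus a constant.  A vertex other than
   the v_i has all its neighbours in its own piece, so it is maximally distant
   from w iff it is so, in its piece, from the gate of w.  Each v_i has
   neighbours both in G_i and in H, one of which is farther away from w. *)
Require Import Defs.
From mathcomp Require Import all_boot.

Set Implicit Arguments.
Unset Strict Implicit.
Unset Printing Implicit Defensive.

Lemma set2_eq (T : finType) (a b x y : T) : [set a; b] = [set x; y] ->
  (a = x /\ b = y) \/ (a = y /\ b = x).
Proof.
move=> E; have: [/\ a \in [set x; y], b \in [set x; y],
    x \in [set a; b] & y \in [set a; b]].
  by split; [rewrite -E | rewrite -E | rewrite E | rewrite E];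
    rewrite !inE eqxx ?orbT.
rewrite !inE => -[/orP[]/eqP-> /orP[]/eqP->]; rewrite ?orbb => /eqP ? /eqP ?;
  by subst; auto.
Qed.

(** * Walks, distances and maximal distance in a single graph *)

Section Distance.

Variable U : finType.
Implicit Types (G : graph U) (x y z w : U) (n : nat).

Lemma adjC G x y : adj G x y = adj G y x.
Proof. by rewrite /adj setUC. Qed.

Lemma adj_in G x y : simple_graph G -> adj G x y ->
  [/\ x \in vertices G, y \in vertices G & x != y].
Proof.
move=> sG /sG[/subsetP sub]; rewrite cards2.
case: (x != y) => // _; split=> //; apply: sub; rewrite !inE eqxx ?orbT //.
Qed.

Lemma has_walk0 G x y : has_walk G x y 0 = (x == y).
Proof.
apply/existsP/idP => [[p]|xy]; first by rewrite tuple0.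
by exists [tuple].
Qed.

Lemma has_walkS G x y n :
  has_walk G x y n.+1 = [exists z, adj G x z && has_walk G z y n].
Proof.
apply/existsP/existsP => [[p]|[z /andP[xz /existsP[p zp]]]].
  case/tupleP: p => z p /= /andP[/andP[xz zp] /eqP <-].
  by exists z; rewrite xz; apply/existsP; exists p; rewrite zp eqxx.
by exists [tuple of z :: p]; rewrite /= xz.
Qed.

Lemma dist_le_walk G x y n : has_walk G x y n -> dist G x y <= n.
Proof.
move=> xy; have le_U : dist G x y <= #|U|.
  by rewrite -[X in _ <= X](size_iota 0) find_size.
case: (ltnP n #|U|) => [ltn|]; last exact: leq_trans.
rewrite leqNgt; apply/negP => lt_n; have := before_find 0 lt_n.
by rewrite nth_iota // add0n xy.
Qed.

(** [dist] searches only the lengths below [#|U|]. Shortening a walk until no vertex repeats gives a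
    length in that range, so the search succeeds. *)
Lemma walk_dist G x y n : has_walk G x y n -> has_walk G x y (dist G x y).
Proof.
move=> /existsP[p /andP[xp /eqP <-{y}]].
case/shortenP: xp => q xq uniq_q _.
have lt_q : size q < #|U|.
  by have := max_card (mem (x :: q)); rewrite (card_uniqP uniq_q).
have hasq : has (has_walk G x (last x q)) (iota 0 #|U|).
  apply/hasP; exists (size q); first by rewrite mem_iota.
  by apply/existsP; exists (in_tuple q); rewrite /= xq eqxx.
have := nth_find 0 hasq; rewrite nth_iota //.
by rewrite -[X in _ < X](size_iota 0) -has_find.
Qed.

Lemma distxx G x : dist G x x = 0.
Proof. by apply/eqP; rewrite -leqn0 dist_le_walk // has_walk0. Qed.

(** A certificate for a guessed distance formula: following the descents gives a walk of length
    [f x], and no walk is shorter because [f] drops by at most one along each edge. *)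
Lemma dist_eq (S : {set U}) G (f : U -> nat) w :
    f w = 0 ->
    (forall x y, adj G x y -> f x <= (f y).+1) ->
    {in S, forall x, x != w ->
       exists y, [/\ y \in S, adj G x y & f x = (f y).+1]} ->
  {in S, forall x, dist G x w = f x}.
Proof.
move=> fw flip fdesc x xS.
have walk_f : has_walk G x w (f x).
  have [n] := ubnP (f x); elim: n x xS => // n IHn x xS; rewrite ltnS => fx.
  have [->|/(fdesc x xS)[y [yS xy fxE]]] := eqVneq x w.
    by rewrite fw has_walk0.
  rewrite fxE has_walkS; apply/existsP; exists y; rewrite xy IHn //.
  by rewrite -fxE.
apply/eqP; rewrite eqn_leq dist_le_walk //=.
have := walk_dist walk_f.
move: (dist G x w) => m {xS walk_f}; elim: m x => [|n IHn] x.
  by rewrite has_walk0 => /eqP->; rewrite fw.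
rewrite has_walkS => /existsP[z /andP[/flip fx /IHn fz]].
exact: leq_trans fx _.
Qed.

Section Connected.

Variable G : graph U.
Hypotheses (G_simple : simple_graph G) (G_conn : connected_graph G).

Lemma connected_walk :
  {in vertices G &, forall x y, has_walk G x y (dist G x y)}.
Proof.
move=> x y xG yG; have /connectP[p xp ->] := G_conn xG yG.
apply: (@walk_dist _ _ _ (size p)); apply/existsP; exists (in_tuple p).
by rewrite xp /=.
Qed.

Lemma dist_adj x y w :
  w \in vertices G -> adj G x y -> dist G x w <= (dist G y w).+1.
Proof.
move=> wG xy; have [_ yG _] := adj_in G_simple xy.
apply: dist_le_walk; rewrite has_walkS; apply/existsP; exists y.
by rewrite xy connected_walk.
Qed.

Lemma dist_descent x w : x \in vertices G -> w \in vertices G -> x != w ->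
  exists y, adj G x y /\ dist G x w = (dist G y w).+1.
Proof.
move=> xG wG xw; have := connected_walk xG wG.
case dxw: (dist G x w) => [|n]; first by rewrite has_walk0 (negPf xw).
rewrite has_walkS => /existsP[y /andP[xy yw]]; exists y; split=> //.
(* The rest of a shortest walk bounds the distance from [y] above; [dist_adj] bounds it below. *)
by apply/eqP; rewrite eqn_leq -{1}dxw dist_adj // ltnS dist_le_walk.
Qed.

Lemma dist_gt0 x w :
  x \in vertices G -> w \in vertices G -> x != w -> 0 < dist G x w.
Proof. by move=> xG wG /(dist_descent xG wG)[y [_ ->]]. Qed.

Lemma exists_adj x : 1 < #|vertices G| -> x \in vertices G ->
  exists y, adj G x y.
Proof.
move=> G_gt1 xG; have [w] : exists w, w \in vertices G :\ x.
  by apply/set0Pn; rewrite -card_gt0; move: G_gt1; rewrite (cardsD1 x) xG.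
rewrite !inE eq_sym => /andP[xw wG].
by have [y []] := dist_descent xG wG xw; exists y.
Qed.

End Connected.

Lemma max_distantP G x w :
  reflect (forall y, adj G x y -> dist G y w <= dist G x w)
          (max_distant G x w).
Proof.
apply: (iffP existsPn) => [md y xy | md y].
  by have := md y; rewrite inE xy -leqNgt.
by rewrite inE negb_and -leqNgt -implybE; apply/implyP/md.
Qed.

Lemma mem_strong_resolving_edges G x y :
    x \in vertices G -> y \in vertices G -> x <> y ->
  ([set x; y] \in edges (strong_resolving_graph G))
    = mutually_max_distant G x y.
Proof.
move=> xG yG /eqP xy; apply/imset2P/idP => [[a b aG] | md].
  rewrite !inE => /and3P[_ ab md] eqE.
  have [xab yab]: x \in [set a; b] /\ y \in [set a; b].
    by rewrite -eqE !inE !eqxx orbT.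
  move: xab yab xy; rewrite !inE => /orP[]/eqP-> /orP[]/eqP->; rewrite ?eqxx //.
  (* The case left over lists the unordered pair in the opposite order. *)
  by move=> _; rewrite /mutually_max_distant andbC.
by exists x y; rewrite ?inE ?yG ?xy.
Qed.

End Distance.

(** * Vertices and edges of the composed graph *)

Section Composition.

Variables (U : finType) (k : nat) (G : 'I_k -> graph U) (H : graph U).
Variables (u v : 'I_k -> U).
Hypothesis G_simple : forall i, simple_graph (G i).
Hypothesis H_simple : simple_graph H.
Hypotheses (G_conn : forall i, connected_graph (G i)).
Hypothesis H_conn : connected_graph H.
Hypotheses (G_card : forall i, 2 <= #|vertices (G i)|).
Hypothesis H_card : 2 <= #|vertices H|.
Hypothesis GG_disj :
  forall i j, i != j -> [disjoint vertices (G i) & vertices (G j)].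
Hypothesis GH_disj : forall i, [disjoint vertices (G i) & vertices H].
Hypotheses (u_in : forall i, u i \in vertices (G i)).
Hypothesis v_in : forall i, v i \in vertices H.

Local Notation J := (composed_graph G H u v).
Implicit Types (i j : 'I_k) (a b w x y : U).

Lemma vertices_G_inj i j x :
  x \in vertices (G i) -> x \in vertices (G j) -> i = j.
Proof.
move=> xi xj; apply/eqP; apply: contraLR xj => /GG_disj dij.
by rewrite (disjointFr dij xi).
Qed.

Lemma vertices_GH i x : x \in vertices (G i) -> x \in vertices H = false.
Proof. exact: disjointFr (GH_disj i). Qed.

Lemma mem_vertices_J x :
  x \in vertices J <->
  x \in vertices H \/ exists2 i, x \in vertices (G i) & x != u i.
Proof.
rewrite !inE; split=> [/andP[xu /orP[/bigcupP[i _ xi]|xH]] | ].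
- right; exists i => //; apply: contraNneq xu => ->.
  exact: imset_f.
- by left.
case=> [xH|[i xi xu]].
  rewrite xH orbT andbT; apply/imsetP => -[i _ xE].
  by rewrite xE (vertices_GH (u_in i)) in xH.
apply/andP; split; last by apply/orP; left; apply/bigcupP; exists i.
apply/imsetP => -[j _ xE]; move: xu.
have xj : x \in vertices (G j) by rewrite xE.
by rewrite (vertices_G_inj xi xj) xE eqxx.
Qed.

(** The gluing map from [G i] into the composed graph, which treats edges at [u i] like all
    others. *)
Definition attach i a := if a == u i then v i else a.

Lemma attach_id i a : a != u i -> attach i a = a.
Proof. by rewrite /attach => /negPf->. Qed.

Lemma attach_u i : attach i (u i) = v i.
Proof. by rewrite /attach eqxx. Qed.

Lemma attach_in i a : a \in vertices (G i) -> attach i a \in vertices J.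
Proof.
move=> ai; apply/mem_vertices_J; rewrite /attach.
by case: eqVneq => [_|au]; [left | right; exists i].
Qed.

(** Through [attach], the surviving edges of [G i] and the new edges at [v i] become a single
    case. *)
Lemma adj_J x y :
  adj J x y <->
  adj H x y \/
    exists i a b, [/\ adj (G i) a b, x = attach i a & y = attach i b].
Proof.
(* Every deleted edge contains some [u i], which is no vertex of [J]; hence no pair of vertices of
   [J] is deleted. *)
have nrem (z w : U) : z \in vertices J -> w \in vertices J ->
    [set z; w] \notin \bigcup_i [set [set a; u i] | a in nbrs (G i) (u i)].
  move=> zJ wJ; apply/bigcupP => -[i _ /imsetP[a _ E]].
  have: u i \in [set z; w] by rewrite E !inE eqxx orbT.
  have uJ : u i \notin vertices J by rewrite !inE imset_f.
  by rewrite !inE => /orP[]/eqP uE; rewrite uE ?zJ ?wJ in uJ.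
split.
  rewrite {1}/adj inE => /andP[rem]; rewrite !inE => /orP[/orP[]|];
    last 1 first.
  - move=> /bigcupP[i _ /imsetP[a]]; rewrite inE => ua /set2_eq.
    have [_ _ nau] := adj_in (@G_simple i) ua.
    have attach_a : attach i a = a by rewrite attach_id // eq_sym.
    case=> -[-> ->]; right; exists i.
      by exists a, (u i); rewrite attach_u attach_a adjC.
    by exists (u i), a; rewrite attach_u attach_a.
  (* An edge of [G i] that survived the deletion avoids [u i], so [attach i] fixes both ends. *)
  - move=> /bigcupP[i _ xy]; right; exists i, x, y.
    split=> //; rewrite attach_id //; apply: contraNneq rem => E;
      apply/bigcupP; exists i => //; apply/imsetP.
      by exists y; rewrite -?E 1?setUC // inE.
    by exists x; rewrite -?E // inE adjC.
  by left.
case=> [xy|[i [a [b [ab xE yE]]]]].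
  have [xH yH _] := adj_in H_simple xy.
  have [xJ yJ] : x \in vertices J /\ y \in vertices J.
    by split; apply/mem_vertices_J; left.
  by rewrite /adj inE nrem // !inE -/(adj H x y) xy orbT.
have [ai bi nab] := adj_in (@G_simple i) ab.
rewrite /adj inE nrem ?xE ?yE ?attach_in // !inE.
rewrite /attach; case: eqVneq => [aE|an]; case: eqVneq => [bE|bn].
- by rewrite aE bE eqxx in nab.
- apply/orP; right; apply/bigcupP; exists i => //; apply/imsetP.
  exists b; last exact: setUC.
  by rewrite inE -aE.
- apply/orP; right; apply/bigcupP; exists i => //; apply/imsetP; exists a => //.
  by rewrite inE adjC -bE.
by apply/orP; left; apply/orP; left; apply/bigcupP; exists i.
Qed.

(** * Gates and a closed formula for the distance in the composed graph *)

Definition gate i w := if w \in vertices (G i) then w else u i.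

Definition gateH w :=
  if [pick i | w \in vertices (G i)] is Some i then v i else w.

(** The additive constant seen from [H]: how far [w] lies behind [gateH w]. *)
Definition height w :=
  if [pick i | w \in vertices (G i)] is Some i then dist (G i) (u i) w else 0.

(** The additive constant seen from [G i]: the way from [v i] through [H] to the gate of [w], then
    on to [w]. *)
Definition offset i w :=
  if w \in vertices (G i) then 0 else dist H (v i) (gateH w) + height w.

Definition J_dist x w :=
  if [pick i | x \in vertices (G i)] is Some i
  then dist (G i) x (gate i w) + offset i w
  else dist H x (gateH w) + height w.

Lemma pickG (T : Type) i x (f : 'I_k -> T) c : x \in vertices (G i) ->
  (if [pick j | x \in vertices (G j)] is Some j then f j else c) = f i.
Proof.
move=> xi; case: pickP => [j xj|/(_ i)]; last by rewrite xi.
by rewrite (vertices_G_inj xj xi).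
Qed.

Lemma pickH (T : Type) x (f : 'I_k -> T) c : x \in vertices H ->
  (if [pick j | x \in vertices (G j)] is Some j then f j else c) = c.
Proof. by move=> xH; case: pickP => // j /vertices_GH; rewrite xH. Qed.

Lemma gate_in i w : gate i w \in vertices (G i).
Proof. by rewrite /gate; case: ifP. Qed.

Lemma gateH_G i w : w \in vertices (G i) -> gateH w = v i.
Proof. exact: pickG. Qed.

Lemma gateH_H w : w \in vertices H -> gateH w = w.
Proof. exact: pickH. Qed.

Lemma gateH_in w : w \in vertices J -> gateH w \in vertices H.
Proof.
move=> /mem_vertices_J[wH|[i wi _]]; first by rewrite gateH_H.
by rewrite (gateH_G wi).
Qed.

Lemma J_dist_H x w : x \in vertices H ->
  J_dist x w = dist H x (gateH w) + height w.
Proof. exact: pickH. Qed.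

(** [J_dist] reads the glued vertex [v i] from [H], so agreement with the reading from [G i] has to
    be checked. If [w] lies in [G i], both give the distance from [u i] to [w]; otherwise the gate
    is [u i] itself and both give the offset. *)
Lemma J_dist_attach i a w : a \in vertices (G i) ->
  J_dist (attach i a) w = dist (G i) a (gate i w) + offset i w.
Proof.
rewrite /attach; case: eqVneq => [-> _|_ ai]; last exact: pickG.
rewrite J_dist_H // /gate /offset; case: ifP => wi; last by rewrite distxx.
by rewrite /height (gateH_G wi) (pickG _ _ wi) distxx addn0.
Qed.

Lemma dist_J x w : x \in vertices J -> w \in vertices J ->
  dist J x w = J_dist x w.
Proof.
move=> xJ wJ; apply: (dist_eq (S := vertices J) (f := J_dist^~ w)) xJ.
- case/mem_vertices_J: wJ => [wH|[i wi wu]].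
    by rewrite J_dist_H // gateH_H // distxx /height pickH.
  by rewrite -(attach_id wu) J_dist_attach // attach_id // /gate /offset wi
    distxx.
(* Each edge of [J] stays in one piece, where [J_dist] is a distance to a fixed gate plus a
   constant. *)
- move=> {}x y /adj_J[xy|[i [a [b [ab -> ->]]]]].
    have [xH yH _] := adj_in H_simple xy.
    by rewrite !J_dist_H // -addSn leq_add2r dist_adj // gateH_in.
  have [ai bi _] := adj_in (@G_simple i) ab.
  by rewrite !J_dist_attach // -addSn leq_add2r dist_adj // gate_in.
(* Inside the copy of [G i], any vertex other than the gate can step towards the gate. *)
have descG i a : a \in vertices (G i) -> a != gate i w ->
    exists y, [/\ y \in vertices J, adj J (attach i a) y
                & J_dist (attach i a) w = (J_dist y w).+1].
  move=> ai a_gate; have [b [ab E]] :=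
    dist_descent (@G_simple i) (@G_conn i) ai (gate_in i w) a_gate.
  have [_ bi _] := adj_in (@G_simple i) ab.
  exists (attach i b); rewrite attach_in //; split=> //.
    by apply/adj_J; right; exists i, a, b.
  by rewrite !J_dist_attach // E.
move=> {}x /mem_vertices_J[xH|[i xi xu]] xw; last first.
  rewrite -(attach_id xu); apply: descG => //.
  by rewrite /gate; case: ifP.
(* If [x] is the gate of [w] in [H] but not [w], then [w] lies in some [G i] and [x] is [v i]; the
   descent continues in [G i] from [u i]. *)
have [xE|xg] := eqVneq x (gateH w).
  case/mem_vertices_J: wJ => [wH|[i wi wu]].
    by rewrite xE gateH_H ?eqxx in xw.
  rewrite xE (gateH_G wi) -attach_u; apply: descG => //.
  by rewrite /gate wi eq_sym.
have [y [xy E]] := dist_descent H_simple H_conn xH (gateH_in wJ) xg.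
have [_ yH _] := adj_in H_simple xy.
exists y; split; first by apply/mem_vertices_J; left.
  by apply/adj_J; left.
by rewrite !J_dist_H // E.
Qed.

(** * Maximal distance in the composed graph *)

Lemma max_distant_J_G i x w :
    x \in vertices (G i) -> x != u i -> w \in vertices J ->
  max_distant J x w = max_distant (G i) x (gate i w).
Proof.
move=> xi xu wJ.
have xJ : x \in vertices J by apply/mem_vertices_J; right; exists i.
have dxw : dist J x w = dist (G i) x (gate i w) + offset i w.
  by rewrite dist_J // -{1}(attach_id xu) J_dist_attach.
apply/max_distantP/max_distantP => md y xy.
  have [_ yi _] := adj_in (@G_simple i) xy.
  have: adj J x (attach i y).
    by apply/adj_J; right; exists i, x, y; rewrite attach_id.
  by move=> /md; rewrite dxw dist_J ?attach_in // J_dist_attach // leq_add2r.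
case/adj_J: xy => [/(adj_in H_simple)[]|[j [a [b [ab xE ->]]]]].
  by rewrite (vertices_GH xi).
have [aj bj _] := adj_in (@G_simple j) ab.
(* An edge starting at the image of [u j] starts at [v j] in [H], whereas [x] lies in [G i]. *)
have [aE|au] := eqVneq a (u j).
  by move: (vertices_GH xi); rewrite xE aE attach_u v_in.
rewrite attach_id // in xE; subst a.
have ij := vertices_G_inj aj xi; subst j.
by rewrite dxw dist_J ?attach_in // J_dist_attach // leq_add2r md.
Qed.

Lemma max_distant_J_H x w :
    x \in vertices H -> x \notin [set v i | i : 'I_k] -> w \in vertices J ->
  max_distant J x w = max_distant H x (gateH w).
Proof.
move=> xH xv wJ.
have dJH y : y \in vertices H ->
    dist J y w = dist H y (gateH w) + height w.
  by move=> yH; rewrite dist_J ?J_dist_H //; apply/mem_vertices_J; left.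
apply/max_distantP/max_distantP => md y xy.
  have [_ yH _] := adj_in H_simple xy.
  have /md : adj J x y by apply/adj_J; left.
  by rewrite !dJH // leq_add2r.
case/adj_J: xy => [xy|[i [a [b [ab xE _]]]]].
  have [_ yH _] := adj_in H_simple xy.
  by rewrite !dJH // leq_add2r md.
have [ai _ _] := adj_in (@G_simple i) ab.
move: xE; rewrite /attach; case: eqVneq => _ xE.
  by case/imsetP: xv; exists i.
by rewrite -xE in ai; rewrite (vertices_GH ai) in xH.
Qed.

(** If [w] lies in [G i], its gate in [H] is [v i], and any neighbour of [v i] in [H] is farther
    away. Otherwise its gate in [G i] is [u i], and the image of any neighbour of [u i] is farther.
    Such neighbours exist because the pieces are connected with at least two vertices. *)
Lemma max_distant_J_v i w : w \in vertices J -> ~~ max_distant J (v i) w.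
Proof.
move=> wJ; have vJ : v i \in vertices J by apply/mem_vertices_J; left.
apply/max_distantP => md; case wi: (w \in vertices (G i)).
  have [y vy] := exists_adj H_simple H_conn H_card (v_in i).
  have [_ yH vy_neq] := adj_in H_simple vy.
  have yJ : y \in vertices J by apply/mem_vertices_J; left.
  have /md : adj J (v i) y by apply/adj_J; left.
  rewrite !dist_J // !J_dist_H // leq_add2r (gateH_G wi) distxx leqNgt.
  by rewrite dist_gt0 // eq_sym.
have [a ua] := exists_adj (@G_simple i) (@G_conn i) (G_card i) (u_in i).
have [_ ai ua_neq] := adj_in (@G_simple i) ua.
have /md : adj J (v i) (attach i a).
  by apply/adj_J; right; exists i, (u i), a; rewrite attach_u.
rewrite !dist_J ?attach_in // -attach_u !J_dist_attach // leq_add2r.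
by rewrite /gate wi distxx leqNgt dist_gt0 // eq_sym.
Qed.

End Composition.

Theorem theorem1 (U : finType) (k : nat) (k_ge1 : 1 <= k)
  (G : 'I_k -> graph U) (H : graph U) (u v : 'I_k -> U)
  (G_simple : forall i, simple_graph (G i)) (H_simple : simple_graph H)
  (G_conn : forall i, connected_graph (G i)) (H_conn : connected_graph H)
  (G_card : forall i, 2 <= #|vertices (G i)|) (H_card : 2 <= #|vertices H|)
  (GG_disj : forall i j, i != j -> [disjoint vertices (G i) & vertices (G j)])
  (GH_disj : forall i, [disjoint vertices (G i) & vertices H])
  (u_in : forall i, u i \in vertices (G i))
  (v_in : forall i, v i \in vertices H)
  (w1 w2 : U)
  (w1_in : w1 \in vertices (composed_graph G H u v))
  (w2_in : w2 \in vertices (composed_graph G H u v))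
  (w12 : w1 <> w2) :
  [set w1; w2] \in edges (strong_resolving_graph (composed_graph G H u v))
  <->
  [/\ w1 \notin [set v i | i : 'I_k],
      w2 \notin [set v i | i : 'I_k] &
      exists x y : U, ((x = w1 /\ y = w2) \/ (x = w2 /\ y = w1)) /\
      [\/ exists i : 'I_k,
            [/\ x \in vertices (G i), y \in vertices (G i) &
                mutually_max_distant (G i) x y],
          [/\ x \in vertices H, y \in vertices H &
              mutually_max_distant H x y],
          exists i j : 'I_k,
            [/\ i < j, x \in vertices (G i), y \in vertices (G j),
                max_distant (G i) x (u i) & max_distant (G j) y (u j)] |
          exists i : 'I_k,
            [/\ x \in vertices (G i), y \in vertices H,
                max_distant (G i) x (u i) & max_distant H y (v i)]]].
Proof.
set J := composed_graph G H u v in w1_in w2_in *.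
have mdG := max_distant_J_G G_simple H_simple G_conn H_conn
  GG_disj GH_disj u_in v_in.
have mdH := max_distant_J_H G_simple H_simple G_conn H_conn
  GG_disj GH_disj u_in v_in.
have mdv := max_distant_J_v G_simple H_simple G_conn H_conn G_card H_card
  GG_disj GH_disj u_in v_in.
have JP := mem_vertices_J v GG_disj GH_disj u_in.
have gateE i w : w \in vertices (G i) -> gate G u i w = w.
  by rewrite /gate => ->.
have gateN i w : w \notin vertices (G i) -> gate G u i w = u i.
  by rewrite /gate => /negPf->.
have gHG := gateH_G v GG_disj; have gHH := gateH_H v GH_disj.
have notG i w : w \in vertices H -> w \notin vertices (G i).
  by apply: contraL => /(vertices_GH GH_disj)->.
have notGj i j w : i != j -> w \in vertices (G j) -> w \notin vertices (G i).
  by move=> ij wj; apply: contra ij => wi;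
    rewrite (vertices_G_inj GG_disj wi wj).
rewrite mem_strong_resolving_edges //; split.
  case/andP => md12 md21.
  have nv w w' : w' \in vertices J -> max_distant J w w' ->
      w \notin [set v i | i : 'I_k].
    by move=> w'J md; apply/imsetP => -[i _ wE]; move: md;
      rewrite wE (negPf (mdv i _ w'J)).
  have nv1 := nv _ _ w2_in md12; have nv2 := nv _ _ w1_in md21; split=> //.
  (* The pieces containing [w1] and [w2] decide which alternative holds. *)
  case/JP: (w1_in) => [w1H|[i w1i w1u]]; case/JP: (w2_in) => [w2H|[j w2j w2u]].
  - exists w1, w2; split; [by left|apply: Or42]; split=> //.
    by rewrite mdH // gHH // in md12; rewrite mdH // gHH // in md21; apply/andP.
  (* The fourth alternative names the vertex outside [H] first, hence the swap. *)
  - exists w2, w1; split; [by right|apply: Or44]; exists j; split=> //.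
      by rewrite (mdG j) // gateN ?notG // in md21.
    by rewrite mdH // (gHG j) // in md12.
  - exists w1, w2; split; [by left|apply: Or44]; exists i; split=> //.
      by rewrite (mdG i) // gateN ?notG // in md12.
    by rewrite mdH // (gHG i) // in md21.
  have [ij|nij] := eqVneq i j.
    subst j; exists w1, w2; split; [by left|apply: Or41]; exists i; split=> //.
    by rewrite (mdG i) // gateE // in md12;
      rewrite (mdG i) // gateE // in md21; apply/andP.
  have nji : j != i by rewrite eq_sym.
  rewrite (mdG i) // gateN ?(notGj i j) // in md12.
  rewrite (mdG j) // gateN ?(notGj j i) // in md21.
  (* The third alternative requires increasing indices, so the pair is listed in that order. *)
  case: (ltngtP i j) => [lt_ij|lt_ji|/val_inj/eqP]; last by rewrite (negPf nij).
    by exists w1, w2; split; [left|apply: Or43; exists i, j].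
  by exists w2, w1; split; [right|apply: Or43; exists j, i].
case=> nv1 nv2 [x [y [xyE cases]]].
(* Mutual maximal distance is symmetric, so either naming of the pair gives the claim. *)
suff: mutually_max_distant J x y.
  by case: xyE => -[-> ->] //; rewrite /mutually_max_distant andbC.
have [xJ yJ nvx nvy] : [/\ x \in vertices J, y \in vertices J,
    x \notin [set v i | i : 'I_k] & y \notin [set v i | i : 'I_k]].
  by case: xyE => -[-> ->].
have nu i w : w \in vertices J -> w != u i.
  by rewrite !inE => /andP[+ _]; apply: contraNneq => ->; apply: imset_f.
rewrite /mutually_max_distant.
case: cases => [[i [xi yi]] | [xH yH] | [i [j [lt_ij xi yj mdx mdy]]]
  | [i [xi yH mdx mdy]]].
(* In each alternative the gates turn the conditions in the pieces into those in [J]. *)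
- by rewrite !(mdG i) ?nu // !gateE.
- by rewrite !mdH // !gHH.
- have nij : i != j by rewrite -val_eqE ltn_eqF.
  rewrite (mdG i) ?nu // (mdG j) ?nu // !gateN ?mdx //.
    by rewrite (notGj j i) // eq_sym.
  by rewrite (notGj i j).
by rewrite (mdG i) ?nu // mdH // gateN ?notG // (gHG i) // mdx.
Qed.
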